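(* Let $A$ be a simple infinite-dimensional Banach associative algebra. If its center $Z_{A}=\{0\}$, then $\mathcal{F}(A)=\overline{[A,A]}$, where $A$ is considered as a Banach Lie algebra with respect to the Lie bracket $[a,b]=ab-ba$ and $\overline{[A,A]}$ is the closed linear span of all commutators.
   Context: Algebras are complex. ''Simple'' is understood in the Banach-algebra sense: $A$ has no closed two-sided ideals other than $\{0\}$ and $A$. A Banach Lie algebra is a complex Lie algebra $\mathcal{L}$ which is a Banach space in a norm such that, for some $t_{\mathcal{L}}>0$, $\|[a,b]\|\leq t_{\mathcal{L}}\|a\|\|b\|$ for all $a,b\in\mathcal{L}$. Frattini radical $\mathcal{F}$. $P_{\mathfrak{J}}(\mathcal{L})$ is the intersection of all proper closed Lie ideals of finite codimension in $\mathcal{L}$ (and equals $\mathcal{L}$ if there are none). Put $P_{\mathfrak{J}}^{0}(\mathcal{L})=\mathcal{L}$, $P_{\mathfrak{J}}^{\alpha+1}(\mathcal{L})=P_{\mathfrak{J}}(P_{\mathfrak{J}}^{\alpha}(\mathcal{L}))$, $P_{\mathfrak{J}}^{\alpha}(\mathcal{L})=\bigcap_{\alpha'<\alpha}P_{\mathfrak{J}}^{\alpha'}(\mathcal{L})$ for limit ordinals $\alpha$; $\mathcal{F}(\mathcal{L})$ is the value at which this decreasing transfinite sequence of closed Lie ideals stabilizes. (The same $\mathcal{F}$ is obtained from closed proper subalgebras of finite codimension in place of ideals.) *)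

(* Defs.v *)
From HB Require Import structures.
From mathcomp Require Import all_boot all_order all_algebra.
From mathcomp Require Import all_classical all_reals all_analysis.
From mathcomp Require Import complex.
From mathcomp Require wochoice.

Set Implicit Arguments.
Unset Strict Implicit.
Unset Printing Implicit Defensive.

Import Order.TTheory GRing.Theory Num.Theory.
Import numFieldNormedType.Exports.

Local Open Scope classical_set_scope.
Local Open Scope ring_scope.

Declare Scope banach_scope.
Delimit Scope banach_scope with B.
Local Open Scope banach_scope.

(** Banach algebras are not assumed to be unital, hence they cannot extend the
    ring structures of MathComp. *)
HB.mixin Record CompleteNormedModule_isBanachAlgebra (K : numFieldType) A
    of CompleteNormedModule K A := {
  bmul : A -> A -> A;
  bmulA : associative bmul;
  bmul_linearl : forall y, linear (bmul^~ y);
  bmul_linearr : forall x, linear (bmul x);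
  ler_norm_bmul : forall x y, `|bmul x y| <= `|x| * `|y|
}.

#[short(type="banachAlgType")]
HB.structure Definition BanachAlgebra (K : numFieldType) :=
  {A of CompleteNormedModule K A & CompleteNormedModule_isBanachAlgebra K A}.

Notation "x ** y" := (bmul x y) (at level 40, left associativity) : banach_scope.

HB.mixin Record CompleteNormedModule_isBanachLie (K : numFieldType) L
    of CompleteNormedModule K L := {
  lie : L -> L -> L;
  lie_linearl : forall y, linear (lie^~ y);
  lie_linearr : forall x, linear (lie x);
  liexx : forall x, lie x x = 0;
  lie_jacobi : forall x y z,
    lie x (lie y z) + lie y (lie z x) + lie z (lie x y) = 0;
  ler_norm_lie : exists2 t : K, 0 < t &
    forall x y, `|lie x y| <= t * `|x| * `|y|
}.

#[short(type="banachLieType")]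
HB.structure Definition BanachLie (K : numFieldType) :=
  {L of CompleteNormedModule K L & CompleteNormedModule_isBanachLie K L}.

Section Subspaces.
Context {K : numFieldType} {V : normedModType K}.
Implicit Types (S J M : set V).

Definition lspan S : set V :=
  [set x | exists n (c : 'I_n -> K) (v : 'I_n -> V),
    (forall i, S (v i)) /\ x = \sum_(i < n) c i *: v i].

Definition finite_dimensional :=
  exists n (v : 'I_n -> V), lspan (range v) = setT.

(** [M / J] is spanned by the classes of finitely many vectors of [M]. *)
Definition finite_codim M J :=
  exists n (v : 'I_n -> V), (forall i, M (v i)) /\
    forall x, M x -> exists2 y, J y & lspan (range v) (x - y).

End Subspaces.
Arguments finite_dimensional {K} V.

Section BanachAlgebraTheory.
Context {K : numFieldType} (A : banachAlgType K).

Definition two_sided_ideal (J : set A) :=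
  submod_closed (mem J) /\ forall a x, J x -> J (a ** x) /\ J (x ** a).

Definition topologically_simple :=
  forall J : set A, closed J -> two_sided_ideal J -> J = [set 0] \/ J = setT.

Definition alg_center : set A := [set z | forall a, z ** a = a ** z].

End BanachAlgebraTheory.
Arguments topologically_simple {K} A.
Arguments alg_center {K} A.

(** The Banach algebra [A] with the bracket [ab - ba]. *)
Definition commutator_lie (K : numFieldType) (A : banachAlgType K) : Type := A.

Section CommutatorLie.
Context {K : numFieldType} (A : banachAlgType K).
Local Notation L := (commutator_lie A).

HB.instance Definition _ := CompleteNormedModule.copy L A.

Definition commutator (x y : A) : A := x ** y - y ** x.

Let commutator_linearl y : linear (commutator^~ y : L -> L).
Proof.
move=> a u v; rewrite /commutator (bmul_linearl y) (bmul_linearr y).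
by rewrite scalerBr opprD addrACA.
Qed.

Let commutator_linearr x : linear (commutator x : L -> L).
Proof.
move=> a u v; rewrite /commutator (bmul_linearl x) (bmul_linearr x).
by rewrite scalerBr opprD addrACA.
Qed.

Let commutatorxx (x : L) : commutator x x = 0.
Proof. exact: subrr. Qed.

Let bmulBl (x y z : A) : (x - y) ** z = x ** z - y ** z.
Proof.
by have := bmul_linearl z (- 1) y x; rewrite /= !scaleN1r ![- _ + _]addrC.
Qed.

Let bmulBr (x y z : A) : z ** (x - y) = z ** x - z ** y.
Proof.
by have := bmul_linearr z (- 1) y x; rewrite /= !scaleN1r ![- _ + _]addrC.
Qed.

Let commutator_jacobi (x y z : L) :
  commutator x (commutator y z) + commutator y (commutator z x)
    + commutator z (commutator x y) = 0.
Proof.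
rewrite /commutator !bmulBl !bmulBr !bmulA.
set a := x ** y ** z; set b := x ** z ** y; set c := y ** z ** x.
set d := z ** y ** x; set e := y ** x ** z; set f := z ** x ** y.
have E (u v w s : A) : u - v - (w - s) = (u + s) - (v + w).
  by rewrite opprB opprD addrACA.
rewrite !E [c + b]addrC [f + e]addrC [d + a]addrC.
by rewrite subrKA subrKA subrr.
Qed.

Let ler_norm_commutator : exists2 t : K, 0 < t &
  forall x y : L, `|commutator x y : L| <= t * `|x| * `|y|.
Proof.
exists 2 => // x y; rewrite -mulrA mulr_natl mulr2n.
apply: (le_trans (ler_normB _ _)); rewrite lerD ?ler_norm_bmul//.
by rewrite [leRHS]mulrC ler_norm_bmul.
Qed.

HB.instance Definition _ := CompleteNormedModule_isBanachLie.Build K L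
  commutator_linearl commutator_linearr commutatorxx commutator_jacobi
  ler_norm_commutator.

End CommutatorLie.


(** Ordinals are represented as the elements of well-ordered types: the element
    [i] stands for the order type of the elements below it. *)
Section TransfiniteIteration.
Context {T : Type} (f : set T -> set T).

Section WellOrder.
Context {I : Type} (le : rel I).

Definition strictly_below i j := le i j /\ i <> j.

Definition is_zero i := forall j, ~ strictly_below j i.

Definition is_succ i j := strictly_below i j /\
  forall k, ~ (strictly_below i k /\ strictly_below k j).

Definition is_limit j := ~ is_zero j /\ forall i, ~ is_succ i j.

(** [P i] is the [i]-th transfinite iterate of [f] starting from [setT]. *)
Definition transfinite_iterates (P : I -> set T) :=
  [/\ forall i, is_zero i -> P i = setT,
      forall i j, is_succ i j -> P j = f (P i) &
      forall j, is_limit j ->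
        P j = \bigcap_(i in [set i | strictly_below i j]) P i].

End WellOrder.

Definition stabilizes_at (S : set T) := exists (I : Type) (le : rel I),
  wochoice.well_order le /\
  exists2 P, transfinite_iterates le P & exists2 i, P i = S & f S = S.

Section WellOrderTheory.
Context {I : Type} (le : rel I) (wo : wochoice.well_order le).
Local Notation lt := (strictly_below le).

Lemma wo_min (X : set I) : X !=set0 ->
  exists2 i, X i & forall j, X j -> le i j.
Proof.
move=> [x Xx]; have [|i [[Xi mi] _]] := wo (A := fun j => `[< X j >]).
  by exists x; apply/asboolP.
exists i => [|j Xj]; first exact/asboolP.
by apply: mi; apply/asboolP.
Qed.

Lemma wo_total i j : le i j \/ le j i.
Proof.
have [|k [->|->] mk] := wo_min (X := [set k | k = i \/ k = j]).
- by exists i; left.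
- by left; apply: mk; right.
- by right; apply: mk; left.
Qed.

Lemma wo_anti i j : le i j -> le j i -> i = j.
Proof.
move=> ij ji.
have rr k : le k k by case: (wo_total k k).
have [|z [_ uz]] := wo (A := fun k => `[< k = i \/ k = j >]).
  by exists i; apply/asboolP; left.
rewrite -(uz i) ?(uz j)//; split.
- by apply/asboolP; right.
- by move=> k /asboolP[->|->].
- by apply/asboolP; left.
- by move=> k /asboolP[->|->].
Qed.

Lemma lt_trichotomy i j : [\/ lt i j, i = j | lt j i].
Proof.
have [->|ij] := pselect (i = j); first exact: Or32.
by case: (wo_total i j) => h; [apply: Or31|apply: Or33]; split=> // /esym.
Qed.

Lemma lt_asym i j : lt i j -> ~ lt j i.
Proof. by move=> [ij nij] [ji _]; apply: nij; exact: wo_anti. Qed.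

Lemma lt_irr i : ~ lt i i. Proof. by case. Qed.

Lemma wo_wf : well_founded lt.
Proof.
move=> i; apply: contrapT => ni.
have [|m nm mm] := wo_min (X := [set i | ~ Acc lt i]); first by exists i.
apply: nm; constructor=> j jm; apply: contrapT => /mm mj.
by case: jm => jm; apply; exact: wo_anti.
Qed.

Lemma lt_trans' j i k : lt i j -> lt j k -> lt i k.
Proof.
move=> ij jk.
have [|m /= h mm] := wo_min (X := [set m | [\/ m = i, m = j | m = k]]).
  by exists i; exact: Or31.
have ltNle u v : le u v -> lt v u -> False.
  by move=> uv [vu]; apply; exact: wo_anti.
have mi : m = i.
  case: h => // e; subst m.
    by case: (ltNle j i) => //; apply: mm; exact: Or31.
  by case: (ltNle k j) => //; apply: mm; exact: Or32.
subst m; split; first by apply: mm; exact: Or33.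
by move=> e; subst k; exact: lt_asym jk.
Qed.

Lemma lt_succ i j : lt i j -> exists k, is_succ le i k /\ (k = j \/ lt k j).
Proof.
move=> ij; have [|k ik mk] := wo_min (X := [set k | lt i k]); first by exists j.
exists k; split.
  by split=> // l [il [lk nlk]]; apply: nlk; apply: wo_anti lk _; exact: mk.
by have [->|nkj] := pselect (k = j); [left|right; split=> //; exact: mk].
Qed.

Lemma wo_case j : [\/ is_zero le j, exists i, is_succ le i j | is_limit le j].
Proof.
have [|nz] := pselect (is_zero le j); first exact: Or31.
have [[i h]|ns] := pselect (exists i, is_succ le i j); first by apply: Or32; exists i.
by apply: Or33; split=> // i h; apply: ns; exists i.
Qed.

End WellOrderTheory.

Hypothesis fS : forall M, f M `<=` M.

Lemma transfinite_iteratesE (I : Type) (le : rel I) (P : I -> set T) :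
  wochoice.well_order le ->
  transfinite_iterates le P <->
  forall i, P i = \bigcap_(j in [set j | strictly_below le j i]) f (P j).
Proof.
move=> wo; split=> [[P0 PS Plim]|PE].
  have sub i j : strictly_below le j i -> P i `<=` f (P j).
    elim/(well_founded_ind (wo_wf wo)): i j => i IH j ji.
    have [i0|[k ki]|li] := wo_case le i; first by case: (i0 j).
      rewrite (PS _ _ ki); case: ki => ki nk.
      case: (lt_trichotomy wo k j) => [kj|->//|jk]; first by case: (nk j).
      exact: (subset_trans (@fS _) (IH k ki j jk)).
    have [s [js [si|si]]] := lt_succ wo ji; first by subst s; case: (li.2 j).
    by rewrite -(PS _ _ js) (Plim _ li) => x; apply.
  move=> i; rewrite eqEsubset; split=> [x Px j ji|]; first exact: sub ji _ Px.
  have [i0|[k ki]|li] := wo_case le i; first by rewrite P0.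
    by rewrite (PS _ _ ki) => x; apply; exact: ki.1.
  by rewrite (Plim _ li) => x Px j ji; apply: fS; exact: Px.
split=> [i i0|i j ij|j [_ ns]].
- by rewrite PE; apply/seteqP; split=> // x _ k /i0.
- rewrite PE eqEsubset; split=> [x|x Px k /= kj]; first by apply; exact: ij.1.
  case: (lt_trichotomy wo k i) => [ki|->//|ik]; last by case: (ij.2 k).
  by move: (fS Px); rewrite PE; exact.
- rewrite PE eqEsubset; split=> x Px i ij; first by apply: fS; exact: Px.
  have [s [is_ [e|sj]]] := lt_succ wo ij; first by subst s; case: (ns i).
  by have := Px s sj; rewrite PE; apply; exact: is_.1.
Qed.

Lemma transfinite_iterates_comparison (I I' : Type) (le : rel I) (le' : rel I')
    (P : I -> set T) (P' : I' -> set T) :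
  wochoice.well_order le -> wochoice.well_order le' ->
  transfinite_iterates le P -> transfinite_iterates le' P' ->
  forall i i', P i `<=` P' i' -> P i = P' i' \/ P i `<=` f (P' i').
Proof.
move=> wo wo' /(transfinite_iteratesE _ wo) PE /(transfinite_iteratesE _ wo') PE'.
suff H i : (forall i', P i `<=` P' i' -> P i = P' i' \/ P i `<=` f (P' i')) /\
    (forall i', P i `<=` P' i' \/ P' i' `<=` f (P i)).
  by move=> i; have [] := H i.
elim/(well_founded_ind (wo_wf wo)): i => i IH.
have D i' : P i `<=` P' i' -> P i = P' i' \/ P i `<=` f (P' i').
  move=> ii'.
  have [[j ji jj']|nj] := pselect
      (exists2 j, strictly_below le j i & P j `<=` P' i').
    have Pij : P i `<=` f (P j) by rewrite {1}PE => x; apply.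
    have [e|h] := (IH j ji).1 i' jj'; first by right; rewrite -e.
    by right; apply: subset_trans h; apply: subset_trans Pij (@fS _).
  left; rewrite eqEsubset; split=> //; rewrite (PE i) => x Px j ji.
  by have [h|] := (IH j ji).2 i'; [case: nj; exists j|apply].
split=> // i'; elim/(well_founded_ind (wo_wf wo')): i' => i' IH'.
have [[k ki' nk]|nk] := pselect
    (exists2 k, strictly_below le' k i' & ~ P i `<=` f (P' k)).
  have Pik : P' i' `<=` f (P' k) by rewrite {1}PE' => x; apply.
  right; have [h|h] := IH' k ki'; last first.
    exact: subset_trans Pik (subset_trans (@fS _) h).
  by have [->|/nk] := D k h.
left; rewrite PE' => x Px k ki'.
by apply: contrapT => nf; apply: nk; exists k => // h; apply: nf; exact: h.
Qed.

Lemma stabilizes_at_unique S S' : stabilizes_at S -> stabilizes_at S' -> S = S'.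
Proof.
suff H U V : stabilizes_at U -> stabilizes_at V -> U `<=` V.
  by move=> hS hS'; rewrite eqEsubset; split; exact: H.
move=> [I [le [wo [P Pit [i <- fPi]]]]] [I' [le' [wo' [P' P'it [i' <- _]]]]].
elim/(well_founded_ind (wo_wf wo')): i' => i' IH.
rewrite ((transfinite_iteratesE _ wo').1 P'it) => x Px k ki'.
have [e|] := transfinite_iterates_comparison wo wo' Pit P'it (IH k ki').
  by rewrite -e fPi.
exact.
Qed.

Lemma stabilizes_at_exists : exists S, stabilizes_at S.
Proof.
have [le wo] := wochoice.well_ordering_principle (set (set T)).
pose step i (Q : forall j, strictly_below le j i -> set T) : set T :=
  [set x | forall j (ji : strictly_below le j i), f (Q j ji) x].
pose P := Fix (wo_wf wo) (fun=> set T) step.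
have PE i : P i = \bigcap_(j in [set j | strictly_below le j i]) f (P j).
  rewrite /P Fix_eq// => j Q Q' QQ'; rewrite /step.
  by apply/seteqP; split=> x Qx k kj; have := Qx k kj; rewrite QQ'.
have Pit : transfinite_iterates le P by exact/transfinite_iteratesE.
have [[i Pi]|nstab] := pselect (exists i, f (P i) = P i).
  by exists (P i), (set (set T)), le; split=> //; exists P => //; exists i.
have ltP i j : strictly_below le i j -> P i <> P j.
  move=> ij e; apply: nstab; exists i; rewrite eqEsubset; split; first exact: fS.
  by rewrite {1}e PE => x; apply.
have Pinj i j : P i = P j -> i = j.
  by move=> e; case: (lt_trichotomy wo i j) => // /ltP; rewrite e.
pose D := [set S | exists2 X, P X = S & ~ X S].
have [DD|nDD] := pselect (D (P D)); last by case: (nDD); exists D.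
by case: (DD) => X /Pinj ->.
Qed.

End TransfiniteIteration.

Section Frattini.
Context {K : numFieldType} (L : banachLieType K).
Implicit Types (J M : set L).

Definition lie_ideal M J :=
  [/\ submod_closed (mem J), J `<=` M & forall a x, M a -> J x -> J (lie a x)].

(** The closed subalgebra [M] of [L] is itself a Banach Lie algebra; its closed
    subsets are the closed subsets of [L] contained in [M]. *)
Definition PJ M : set L :=
  [set x | M x /\ forall J,
    closed J -> lie_ideal M J -> finite_codim M J -> J <> M -> J x].

(** The default value of [xget] is never used: see [frattini_radicalP] and
    [frattini_radical_eq]. *)
Definition frattini_radical : set L :=
  xget setT [set S | stabilizes_at PJ S].

Lemma frattini_radicalP : stabilizes_at PJ frattini_radical.
Proof. by apply: xgetPex; apply: stabilizes_at_exists => M x []. Qed.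

Lemma frattini_radical_eq S : stabilizes_at PJ S -> frattini_radical = S.
Proof.
by apply: stabilizes_at_unique frattini_radicalP => M x [].
Qed.

End Frattini.
Arguments frattini_radical {K} L.

(* Main.v *)
Require Import Defs.
From HB Require Import structures.
From mathcomp Require Import all_boot all_order all_algebra.
From mathcomp Require Import all_classical all_reals all_analysis.
From mathcomp Require Import complex.
From mathcomp Require Import lra ring.
From mathcomp Require wochoice.

(** Write [C] for the closed span of the commutators.  The point is a
    topological version of a theorem of Herstein: a closed subspace [J] with
    [[J, [A, A]] <= J] is zero or contains [[A, A]].  Consider the closed
    subalgebra [S] of all [s] with [[s, A] <= J]; it is stable under
    commutation with [[A, A]] and contains [[J, J]].  Either it contains a
    nonzero ideal of [A], hence is [A]; or, [A] being prime with zero center,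
    one gets successively [[[S, S], S] = 0], [[S, S] = 0], [S = 0] and [J = 0],
    because [[s, [s, [A, A]]] = 0] forces [s = 0].  Finite codimension
    excludes [J = 0], so the closed ideals of finite codimension of [A] contain
    [C], and [C] has no proper one.  Conversely, by the Hahn-Banach theorem, [C]
    is an intersection of closed hyperplanes, which are Lie ideals of [A].  The
    transfinite sequence is thus [A, C, C, ...]. *)

Set Implicit Arguments.
Unset Strict Implicit.
Unset Printing Implicit Defensive.

Import Order.TTheory GRing.Theory Num.Theory.
Import numFieldNormedType.Exports.

Local Open Scope classical_set_scope.
Local Open Scope ring_scope.
Local Open Scope complex_scope.
Local Open Scope banach_scope.

Local Notation "[ 'com' x , y ]" := (commutator x y)
  (at level 0, format "[ 'com'  x ,  y ]") : banach_scope.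

(** * Bilinearity and Leibniz identities for products and commutators *)

Section Commutators.
Context {K : numFieldType} {A : banachAlgType K}.
Implicit Types (x y z s t a b c : A) (k : K).

Lemma bmulDl z x y : (x + y) ** z = x ** z + y ** z.
Proof. by have := bmul_linearl z 1 x y; rewrite /= !scale1r. Qed.

Lemma bmulDr z x y : z ** (x + y) = z ** x + z ** y.
Proof. by have := bmul_linearr z 1 x y; rewrite /= !scale1r. Qed.

Lemma bmul0l x : 0 ** x = 0.
Proof. by apply: (addrI (0 ** x)); rewrite -bmulDl !addr0. Qed.

Lemma bmul0r x : x ** 0 = 0.
Proof. by apply: (addrI (x ** 0)); rewrite -bmulDr !addr0. Qed.

Lemma bmulZl k x y : (k *: x) ** y = k *: (x ** y).
Proof. by have := bmul_linearl y k x 0; rewrite /= bmul0l !addr0. Qed.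

Lemma bmulZr k x y : x ** (k *: y) = k *: (x ** y).
Proof. by have := bmul_linearr x k y 0; rewrite /= bmul0r !addr0. Qed.

Lemma bmulNl x y : (- x) ** y = - (x ** y).
Proof. by rewrite -scaleN1r bmulZl scaleN1r. Qed.

Lemma bmulNr x y : x ** (- y) = - (x ** y).
Proof. by rewrite -scaleN1r bmulZr scaleN1r. Qed.

Lemma bmulBl z x y : (x - y) ** z = x ** z - y ** z.
Proof. by rewrite bmulDl bmulNl. Qed.

Lemma bmulBr z x y : z ** (x - y) = z ** x - z ** y.
Proof. by rewrite bmulDr bmulNr. Qed.

Lemma comC x y : [com x, y] = - [com y, x].
Proof. by rewrite /commutator opprB. Qed.

Lemma comDr x y z : [com x, y + z] = [com x, y] + [com x, z].
Proof. by rewrite /commutator bmulDl bmulDr opprD addrACA. Qed.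

Lemma comZr k x y : [com x, k *: y] = k *: [com x, y].
Proof. by rewrite /commutator bmulZl bmulZr scalerBr. Qed.

Lemma comDl x y z : [com x + y, z] = [com x, z] + [com y, z].
Proof. by rewrite comC comDr opprD -!comC. Qed.

Lemma comZl k x y : [com k *: x, y] = k *: [com x, y].
Proof. by rewrite comC comZr -scalerN -comC. Qed.

Lemma com0r x : [com x, 0] = 0.
Proof. by rewrite -{1}(scale0r 0) comZr scale0r. Qed.

Lemma com0l x : [com 0, x] = 0.
Proof. by rewrite comC com0r oppr0. Qed.

Lemma comNr x y : [com x, - y] = - [com x, y].
Proof. by rewrite -scaleN1r comZr scaleN1r. Qed.

Lemma comMr s x y : [com s, x ** y] = [com s, x] ** y + x ** [com s, y].
Proof. by rewrite /commutator bmulBl bmulBr !bmulA subrKA. Qed.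

Lemma comMl x y a : [com x ** y, a] = [com x, y ** a] + [com y, a ** x].
Proof. by rewrite /commutator !bmulA subrKA. Qed.

Lemma com_com s x y : [com s, [com x, y]] = [com [com s, x], y] + [com x, [com s, y]].
Proof.
rewrite [X in [com s, X]]/commutator comDr comNr !comMr.
set u := [com s, x]; set v := [com s, y]; rewrite /commutator.
by rewrite opprD [- (v ** x) - _]addrC addrACA.
Qed.

Lemma com_coml x y a : [com [com x, y], a] = [com x, [com y, a]] - [com y, [com x, a]].
Proof. by rewrite (com_com x y) addrK. Qed.

End Commutators.

(** * Inner derivations of prime algebras with zero center *)

Section Prime.
Context {K : numFieldType} {A : banachAlgType K}.
Hypothesis primeA : forall a b : A, (forall x, a ** x ** b = 0) -> a = 0 \/ b = 0.
Hypothesis centerA : forall z : A, (forall x, [com z, x] = 0) -> z = 0.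
Implicit Types (x y z s t a b c : A).

(** Put d = [s, _]. By the Leibniz rule d^2 (u v) = 0 becomes 2 (d u)(d v) = 0; then u = x and v = y
    x give (d x) y (d x) = 0, so d x = 0 by primeness and s is central. *)
Lemma ad_sq_eq0 s : (forall x, [com s, [com s, x]] = 0) -> s = 0.
Proof.
move=> d2; apply: centerA => x.
have dd u v : [com s, u] ** [com s, v] = 0.
  have := d2 (u ** v); rewrite comMr comDr !comMr !d2 bmul0l bmul0r addr0 add0r.
  by rewrite -mulr2n -scaler_nat => /eqP; rewrite scaler_eq0 pnatr_eq0 /= => /eqP.
have [] // : [com s, x] = 0 \/ [com s, x] = 0.
apply: primeA => y.
by have := dd x (y ** x); rewrite comMr bmulDr !bmulA dd bmul0l add0r.
Qed.

(** Each d x is a commutator, hence d^3 = 0. Expanding d^2 [x, y] = 0 yields [d^2 x, d y] = 0;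
    primeness then makes every d^2 z central, hence zero, which reduces the claim to [ad_sq_eq0]. *)
Lemma ad_sq_com_eq0 s : (forall x y, [com s, [com s, [com x, y]]] = 0) -> s = 0.
Proof.
move=> d2com; apply: ad_sq_eq0.
pose d x := [com s, x].
have d3 x : d (d (d x)) = 0 by exact: d2com.
have E x y : [com d (d x), y] + [com d x, d y] *+ 2 + [com x, d (d y)] = 0.
  have := d2com x y; rewrite (com_com s x) comDr (com_com s (d x)) (com_com s x).
  by rewrite mulr2n !addrA.
(* Substituting d x for x, or d y for y, in [E] gives two equations in [d^2 x, d y] and
   [d x, d^2 y]; eliminating the latter leaves 3 [d^2 x, d y] = 0. *)
have ddd x y : [com d (d x), d y] = 0.
  have := E x (d y); have := E (d x) y; rewrite !d3 com0l com0r addr0 add0r.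
  move=> e1 e2; apply/eqP.
  suff : [com d (d x), d y] *+ 3 == 0.
    by rewrite -scaler_nat scaler_eq0 pnatr_eq0.
  have e3 : [com d x, d (d y)] = - ([com d (d x), d y] *+ 2).
    by apply/eqP; rewrite -addr_eq0 addrC e1.
  move: e2; rewrite e3 mulNrn -mulrnA => /eqP; rewrite subr_eq0 => /eqP e4.
  by rewrite -(inj_eq (addrI [com d (d x), d y])) -mulrS addr0 -e4.
(* In [ddd] with y (d z) as second variable, this is the only Leibniz term that survives. *)
have dprod x y z : [com d (d x), y] ** d (d z) = 0.
  have := ddd x (y ** d z); rewrite [X in [com _, X]]comMr comDr !comMr.
  rewrite -/(d y) -/(d (d z)).
  by rewrite !ddd bmul0l !bmul0r !addr0 add0r.
move=> z; rewrite -/(d z) -/(d (d z)); apply: centerA => y.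
(* Using [dprod] at y y' inserts the arbitrary middle factor y' that primeness requires. *)
have [|//|dz0] := @primeA [com d (d z), y] (d (d z)); last by rewrite dz0 com0l.
move=> y'; have := dprod z (y ** y') z.
by rewrite comMr bmulDl -[y ** _ ** _]bmulA dprod bmul0r addr0.
Qed.

End Prime.

(** * Subspaces, their spans and closures, and bounded linear maps *)

Section Subspaces.
Context {K : numFieldType} {V : normedModType K}.
Implicit Types (W : set V).

Lemma submod_closedP W : submod_closed (mem W) <->
  W 0 /\ forall k x y, W x -> W y -> W (k *: x + y).
Proof.
split=> -[W0 WD]; split.
- by move: W0; rewrite inE.
- by move=> k x y Wx Wy; have := WD k x y; rewrite !inE; apply.
- by rewrite inE.
- by move=> k x y; rewrite !inE; exact: WD.
Qed.

Lemma subspaceD W : submod_closed (mem W) ->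
  forall x y, W x -> W y -> W (x + y).
Proof.
by move=> /submod_closedP[_ WD] x y Wx Wy; rewrite -(scale1r x); exact: WD.
Qed.

Lemma subspaceZ W : submod_closed (mem W) -> forall k x, W x -> W (k *: x).
Proof.
by move=> /submod_closedP[W0 WD] k x Wx; rewrite -(addr0 (_ *: _)); exact: WD.
Qed.

Lemma subspaceB W : submod_closed (mem W) ->
  forall x y, W x -> W y -> W (x - y).
Proof.
move=> sW x y Wx Wy; apply: subspaceD => //.
by rewrite -scaleN1r; exact: subspaceZ.
Qed.

Lemma subspace_sum W : submod_closed (mem W) -> forall n (c : 'I_n -> K) v,
  (forall i, W (v i)) -> W (\sum_i c i *: v i).
Proof.
move=> sW n c v Wv; elim/big_rec : _ => [|i x _ Wx].
  by have /submod_closedP[] := sW.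
by apply: subspaceD => //; exact: subspaceZ.
Qed.

Lemma subspace_lspan W : submod_closed (mem (lspan W)).
Proof.
apply/submod_closedP; split.
  by exists 0%N, (fun=> 0), (fun=> 0); split; [case|rewrite big_ord0].
move=> k x y [n [c [v [Wv ->]]]] [m [d [w [Ww ->]]]].
exists (n + m)%N,
  (fun i => match fintype.split i with inl j => k * c j | inr j => d j end),
  (fun i => match fintype.split i with inl j => v j | inr j => w j end).
split=> [i|]; first by case: (fintype.split i).
rewrite big_split_ord scaler_sumr; congr (_ + _); apply: eq_bigr => i _.
  by rewrite (unsplitK (inl i)) scalerA.
by rewrite (unsplitK (inr i)).
Qed.

Lemma lspan_sub W W' : submod_closed (mem W') -> W `<=` W' -> lspan W `<=` W'.
Proof.
move=> sW' WW' x [n [c [v [Wv ->]]]].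
by apply: subspace_sum => // i; exact: WW'.
Qed.

Lemma sub_lspan W : W `<=` lspan W.
Proof.
move=> x Wx; exists 1%N, (fun=> 1), (fun=> x); split=> //.
by rewrite big_ord1 scale1r.
Qed.

Lemma closure_min W F : closed F -> W `<=` F -> closure W `<=` F.
Proof. by move=> cF WF x; rewrite closureEbigcap; exact. Qed.

Lemma closed_forall I (F : I -> set V) :
  (forall i, closed (F i)) -> closed [set x | forall i, F i x].
Proof.
move=> cF; rewrite (_ : [set x | _] = \bigcap_i F i); first exact: closed_bigI.
by apply/seteqP; split=> x Fx i //=; exact: Fx.
Qed.

Lemma subspace_closure W : submod_closed (mem W) -> submod_closed (mem (closure W)).
Proof.
move=> /submod_closedP[W0 WD]; apply/submod_closedP.
split; first exact: subset_closure.
move=> k x y Wx Wy.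
(* The two limits are taken one after the other: first in x with y' still in [W], then in y. *)
have D x' y' : W y' -> closure W x' -> closure W (k *: x' + y').
  move=> Wy'; apply: (@closure_min W ((fun x => k *: x + y') @^-1` closure W)).
    apply: preimage_closed (@closed_closure _ _) => z _.
    by apply: cvgD; [exact: cvgZr|exact: cvg_cst].
  by move=> z Wz; apply: subset_closure; exact: WD.
move: y Wy; apply: (@closure_min W ((fun y => k *: x + y) @^-1` closure W)).
  apply: preimage_closed (@closed_closure _ _) => z _.
  by apply: cvgD; [exact: cvg_cst|exact: cvg_id].
by move=> z Wz /=; exact: D.
Qed.

Lemma linear_continuous (f : V -> V) (t : K) : 0 <= t -> linear f ->
  (forall x, `|f x| <= t * `|x|) -> continuous f.
Proof.
move=> t0 lf bf.
pose F : {linear V -> V} := HB.pack f (GRing.isLinear.Build _ _ _ _ f lf).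
apply: (@bounded_linear_continuous _ _ _ F); apply/linear_boundedP.
near=> r => x; apply: le_trans (bf x) _; rewrite ler_wpM2r//.
by near: r; apply: nbhs_pinfty_ge; exact: ger0_real.
Unshelve. all: by end_near. Qed.


End Subspaces.

(** * Continuity of multiplication and commutation *)

Section Continuity.
Context {K : numFieldType} {A : banachAlgType K}.
Implicit Types (a : A).

Lemma bmull_continuous a : continuous (bmul a).
Proof.
apply: (@linear_continuous _ _ _ `|a|) => //; first exact: bmul_linearr.
exact: ler_norm_bmul.
Qed.

Lemma bmulr_continuous a : continuous (bmul^~ a).
Proof.
apply: (@linear_continuous _ _ _ `|a|) => //; first exact: bmul_linearl.
by move=> x; rewrite mulrC; exact: ler_norm_bmul.
Qed.

Lemma com_continuous a : continuous (fun x : A => [com x, a] : A).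
Proof.
by move=> x; exact: cvgB (@bmulr_continuous a x) (@bmull_continuous a x).
Qed.

End Continuity.

(** * Topologically simple algebras with zero center: primeness and Lie ideals *)

Section Simple.
Context {K : numFieldType} {A : banachAlgType K}.
Hypothesis simpleA : topologically_simple A.
Hypothesis centerA : alg_center A = [set 0].
Implicit Types (x y z s t a b c : A).

Lemma com_center z : (forall x, [com z, x] = 0) -> z = 0.
Proof.
move=> zA; suff : alg_center A z by rewrite centerA.
by move=> x; apply/eqP; rewrite -subr_eq0; apply/eqP; exact: zA.
Qed.

Lemma simple_ideal (I : set A) : closed I -> submod_closed (mem I) ->
  (forall a x, I x -> I (a ** x)) -> (forall a x, I x -> I (x ** a)) ->
  (forall x, I x -> x = 0) \/ forall x, I x.
Proof.
move=> cI sI Il Ir; case: (simpleA cI) => [|->|->]; last by right.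
  by split=> // a x Ix; split; [exact: Il|exact: Ir].
by left.
Qed.

Lemma closed_eq0 (f : A -> A) : continuous f -> closed [set x | f x = 0].
Proof.
move=> cf; apply: (@preimage_closed _ _ f [set 0]) => [x _|]; first exact: cf.
by apply: accessible_closed_set1; apply: hausdorff_accessible; exact: norm_hausdorff.
Qed.

(** Such b form a closed two-sided ideal. If it is all of [A], every product is zero, so [A] is
    commutative and equals its zero center. *)
Lemma left_annihilator b : (forall x, x ** b = 0) -> b = 0.
Proof.
move=> b0; have [||a x xI y|a x xI y|I0|AA] :=
    @simple_ideal [set b | forall x, x ** b = 0]; rewrite /= ?bmulA ?xI //.
- by apply: closed_forall => x; apply: closed_eq0; exact: bmull_continuous.
- apply/submod_closedP; split=> [x|k x y xI yI z]; first exact: bmul0r.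
  by rewrite bmulDr bmulZr xI yI scaler0 addr0.
- by rewrite bmul0l.
- exact: I0.
- by apply: com_center => x; rewrite /commutator !AA subrr.
Qed.

Lemma right_annihilator b : (forall x, b ** x = 0) -> b = 0.
Proof.
move=> b0; have [||a x xI y|a x xI y|I0|AA] :=
    @simple_ideal [set b | forall x, b ** x = 0]; rewrite /= -?bmulA ?xI //.
- by apply: closed_forall => x; apply: closed_eq0; exact: bmulr_continuous.
- apply/submod_closedP; split=> [x|k x y xI yI z]; first exact: bmul0l.
  by rewrite bmulDl bmulZl xI yI scaler0 addr0.
- by rewrite bmul0r.
- exact: I0.
- by apply: com_center => x; rewrite /commutator !AA subrr.
Qed.

(** For fixed a, such b form a closed two-sided ideal. If it is all of [A], then a x y = 0 for all x
    and y, and two uses of [right_annihilator] give a = 0. *)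
Lemma simple_prime a b : (forall x, a ** x ** b = 0) -> a = 0 \/ b = 0.
Proof.
move=> ab0; have [||c x xI y|c x xI y|I0|aAA] :=
    @simple_ideal [set b | forall x, a ** x ** b = 0]; rewrite /=.
- by apply: closed_forall => x; apply: closed_eq0; exact: bmull_continuous.
- apply/submod_closedP; split=> [x|k x y xI yI z]; first exact: bmul0r.
  by rewrite bmulDr bmulZr xI yI scaler0 addr0.
- by rewrite bmulA -[a ** y ** c]bmulA xI.
- by rewrite bmulA xI bmul0l.
- by right; exact: I0.
- left; apply: right_annihilator => x; apply: right_annihilator => y.
  exact: aAA.
Qed.

Section LieIdeal.
Variable J : set A.
Hypotheses (cJ : closed J) (sJ : submod_closed (mem J)).
Hypothesis JC : forall j x y, J j -> J [com j, [com x, y]].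

Let S : set A := [set s | forall a, J [com s, a]].

Let J0 : J 0. Proof. by case/submod_closedP: sJ. Qed.

Let cS : closed S.
Proof.
apply: closed_forall => a.
by apply: preimage_closed cJ => x _; exact: com_continuous.
Qed.

Let sS : submod_closed (mem S).
Proof.
apply/submod_closedP; split=> [a|k x y Sx Sy a]; first by rewrite com0l.
by rewrite comDl comZl; apply: subspaceD => //; exact: subspaceZ.
Qed.

(** The identity [x y, a] = [x, y a] + [y, a x] keeps x and y intact inside the brackets. *)
Let SM x y : S x -> S y -> S (x ** y).
Proof. by move=> Sx Sy a; rewrite comMl; exact: subspaceD. Qed.

(** By Jacobi, [[s, [x, y]], a] = [s, [[x, y], a]] - [[x, y], [s, a]]; the second term is in [J] by
    [JC], because [s, a] is. *)
Let SC s x y : S s -> S [com s, [com x, y]].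
Proof.
move=> Ss a; rewrite com_coml; apply: subspaceB => //.
by rewrite comC -scaleN1r; apply: subspaceZ => //; exact: JC.
Qed.

Let JJS j k : J j -> J k -> S [com j, k].
Proof.
by move=> Jj Jk a; rewrite com_coml; apply: subspaceB => //; exact: JC.
Qed.

(** [u ** v] lies in the largest two-sided ideal of [A] contained in [S]. *)
Let full_or_mul_eq0 : (forall x, S x) \/
  forall u v, (forall a, S (a ** u)) -> (forall a, S (v ** a)) -> u ** v = 0.
Proof.
(* In the absence of a unit, the conditions on z, A z, z A and A z A are imposed separately. *)
pose I := S `&` [set z | forall a, S (a ** z)] `&` [set z | forall a, S (z ** a)]
  `&` [set z | forall a b, S (a ** z ** b)].
have cSl a : closed [set z | S (a ** z)].
  by apply: preimage_closed cS => x _; exact: bmull_continuous.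
have cSr a : closed [set z | S (z ** a)].
  by apply: preimage_closed cS => x _; exact: bmulr_continuous.
have cSlr a b : closed [set z | S (a ** z ** b)].
  apply: (@preimage_closed _ _ (bmul a) [set z | S (z ** b)]) => // x _.
  exact: bmull_continuous.
have IE z : S z -> (forall a, S (a ** z)) -> (forall a, S (z ** a)) ->
  (forall a b, S (a ** z ** b)) -> I z by move=> *; do 3?split.
have [||c z|c z|I0|IA] := @simple_ideal I.
- apply: closedI; last first.
    by apply: closed_forall => a; apply: closed_forall => b; exact: cSlr.
  apply: closedI; last exact: closed_forall.
  by apply: closedI => //; exact: closed_forall.
- apply/submod_closedP; have [S0 SD] := (submod_closedP _).1 sS.
  split=> [|k x y [[[Sx Slx] Srx] Slrx] [[[Sy Sly] Sry] Slry]]; apply: IE.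
  + by [].
  + by move=> a; rewrite bmul0r.
  + by move=> a; rewrite bmul0l.
  + by move=> a b; rewrite bmul0r bmul0l.
  + exact: SD.
  + by move=> a; rewrite bmulDr bmulZr; exact: SD.
  + by move=> a; rewrite bmulDl bmulZl; exact: SD.
  + move=> a b; rewrite bmulDr bmulZr bmulDl bmulZl.
    exact: SD.
- by move=> [[[Sz Slz] Srz] Slrz]; apply: IE => [|a|a|a b] //=; rewrite ?bmulA.
- move=> [[[Sz Slz] Srz] Slrz]; apply: IE => [|a|a|a b] //=.
  + by rewrite bmulA.
  + by rewrite -bmulA.
  + by rewrite bmulA -bmulA.
(* Only the products a u and v b are known to lie in [S], so u v is flanked by p and q, which the
   annihilator lemmas introduce. *)
- right=> u v Su Sv; apply: left_annihilator => p; apply: right_annihilator => q.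
  have SS a b : S (a ** u ** (v ** b)) by exact: SM.
  apply: I0; apply: IE => [|a|a|a b].
  + by have := SS p q; rewrite !bmulA.
  + by have := SS (a ** p) q; rewrite !bmulA.
  + by have := SS p (q ** a); rewrite !bmulA.
  + by have := SS (a ** p) (q ** b); rewrite !bmulA.
- by left=> x; have [[[]]] := IA x.
Qed.

(** If [S] is not [A], then [K0] leaves no nonzero u with A u and u A inside [S]. Vanishing then
    passes to [S, S], to [S] and to [J], each time through the square of an inner derivation. *)
Lemma lie_ideal_dichotomy : (forall x y, J [com x, y]) \/ forall x, J x -> x = 0.
Proof.
have [SA|KK0] := full_or_mul_eq0; first by left=> x y; exact: SA.
right.
have K0 u : (forall a, S (a ** u)) -> (forall a, S (u ** a)) -> u = 0.
  move=> Su uS.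
  have uu0 : u ** u = 0 by exact: KK0.
  (* The point is that [u, c] A lies in [S], since c u a = [c, u a] + u a c with both terms in [S].
     Hence u [u, c] = 0, that is u c u = 0 as u^2 = 0. *)
  have ucu x y : u ** [com x, y] ** u = 0.
    set c := [com x, y].
    have : u ** [com u, c] = 0.
      apply: KK0 => // a.
      rewrite /commutator bmulBl -bmulA -[c ** u ** a]bmulA.
      apply: (subspaceB sS) => //.
      rewrite [X in S X](_ : _ = [com c, u ** a] + u ** (a ** c)); last first.
        by rewrite /commutator -[u ** a ** c]bmulA subrK.
      apply: (subspaceD sS) => //.
      by rewrite comC -scaleN1r; apply: (subspaceZ sS) => //; exact: SC.
    rewrite /commutator bmulBr !bmulA uu0 bmul0l sub0r.
    by move/eqP; rewrite oppr_eq0 => /eqP.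
  (* With the commutator [y, x u] in [ucu], the term ending in u^2 drops out and (u x u) y u = 0
     remains. *)
  have uxu x : u ** x ** u = 0.
    have [y|//|//] := @simple_prime (u ** x ** u) u; last by move=> ->; rewrite bmul0r.
    have := ucu y (x ** u); rewrite /commutator bmulBr bmulBl !bmulA.
    by rewrite -[_ ** u ** u]bmulA uu0 bmul0r sub0r => /eqP; rewrite oppr_eq0 => /eqP.
  by case: (simple_prime uxu).
have wS s1 s2 a : S s1 -> S s2 -> S [com [com s1, s2], a].
  by move=> S1 S2; rewrite com_coml; apply: (subspaceB sS) => //; exact: SC.
have SS0 s1 s2 : S s1 -> S s2 -> [com s1, s2] = 0.
  (* For w = [s1, s2], [wS] puts [w, A] inside [S]. The Leibniz rule then shows that [S] contains
     both one-sided multiples of [w, [w, x]], and [K0] applies. *)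
  move=> S1 S2; apply: ad_sq_eq0 simple_prime com_center _ _ => x.
  set w := [com s1, s2].
  apply: K0 => a.
    rewrite (_ : a ** _ = [com w, a ** [com w, x]] - [com w, a] ** [com w, x]).
      by apply: (subspaceB sS) => //; [exact: wS|apply: SM; exact: wS].
    by rewrite comMr addrC addKr.
  rewrite (_ : _ ** a = [com w, [com w, x] ** a] - [com w, x] ** [com w, a]).
    by apply: (subspaceB sS) => //; [exact: wS|apply: SM; exact: wS].
  by rewrite comMr addrK.
have S0 s : S s -> s = 0.
  move=> Ss; apply: ad_sq_com_eq0 simple_prime com_center _ _ => x y.
  by apply: SS0 => //; exact: SC.
move=> j Jj; apply: ad_sq_com_eq0 simple_prime com_center _ _ => x y.
by apply: S0; apply: JJS => //; exact: JC.
Qed.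

End LieIdeal.
End Simple.

(** * The Hahn-Banach theorem through minimal sublinear functionals *)

Section HahnBanach.
Context {R : realType} {V : lmodType R}.
Implicit Types (p q : V -> R) (K : set (V * R)) (x y : V) (t : R).

Definition sublinear q := (forall x y, q (x + y) <= q x + q y) /\
  forall t x, 0 < t -> q (t *: x) <= t * q x.

Lemma sublinear0 q : sublinear q -> q 0 = 0.
Proof.
move=> [qD qZ]; have := qD 0 0; have := qZ (2^-1) 0.
by rewrite scaler0 addr0 invr_gt0 ltr0n => /(_ isT); lra.
Qed.

Lemma sublinearN q x : sublinear q -> - q (- x) <= q x.
Proof. by move=> sq; have := sq.1 x (- x); rewrite subrr sublinear0//; lra. Qed.

(** Take q' x as the infimum of q (x + k) - s over (k, s) in the cone [K]. A linear u below q' then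
    satisfies u x >= s for each (x, s) in [K]. *)
Lemma sublinear_inf q K : sublinear q ->
    K (0, 0) -> (forall k l, K k -> K l -> K (k + l)) ->
    (forall t x s, 0 < t -> K (x, s) -> K (t *: x, t * s)) ->
    (forall x s, K (x, s) -> s <= q x) ->
  exists q', [/\ sublinear q', forall x, q' x <= q x &
    forall x s, K (x, s) -> q' (- x) <= - s].
Proof.
move=> sq K0 KD KZ Kq.
pose E x := [set q (x + k.1) - k.2 | k in K].
have lbE x : has_lbound (E x).
  exists (- q (- x)) => _ [[k s] Kk <-] /=; have := Kq _ _ Kk.
  by have := sq.1 (- x) (x + k); rewrite addKr; lra.
have infE x k s : K (k, s) -> inf (E x) <= q (x + k) - s.
  by move=> Kk; apply: ge_inf => //; exists (k, s).
have le_infE x c : (forall k s, K (k, s) -> c <= q (x + k) - s) -> c <= inf (E x).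
  move=> cE; apply: lb_le_inf; first by exists (q (x + 0) - 0), (0, 0).
  by move=> _ [[k s] Kk <-]; exact: cE.
exists (fun x => inf (E x)); split=> [|x|x s Kx].
- split=> [x y|t x t0].
    rewrite -lerBlDr; apply: (le_infE) => k s Kk; rewrite lerBlDr -lerBlDl.
    apply: (le_infE) => l r Kl; rewrite lerBlDl.
    have := infE (x + y) _ _ (KD _ _ Kk Kl); have := sq.1 (x + k) (y + l).
    by rewrite addrACA /=; lra.
  rewrite mulrC -ler_pdivrMr//; apply: (le_infE) => k s Kk.
  rewrite ler_pdivrMr// mulrC.
  have := infE (t *: x) _ _ (KZ _ _ _ t0 Kk); have := sq.2 t (x + k) t0.
  by rewrite scalerDr; lra.
- by have := infE x _ _ K0; rewrite addr0 subr0.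
- by have := infE (- x) _ _ Kx; rewrite addNr sublinear0// sub0r.
Qed.

(** The pointwise infimum of a chain is the bound that Zorn's lemma asks for. *)
Lemma sublinear_chain p (Q : set (V -> R)) : Q !=set0 ->
    (forall q, Q q -> sublinear q /\ forall x, q x <= p x) ->
    (forall q r, Q q -> Q r -> (forall x, q x <= r x) \/ forall x, r x <= q x) ->
  exists q', [/\ sublinear q', forall x, q' x <= p x &
    forall q, Q q -> forall x, q' x <= q x].
Proof.
move=> [q0 Qq0] sQ tQ; pose E x := [set q x | q in Q].
have lbE x : has_lbound (E x).
  exists (- p (- x)) => _ [q /sQ[sq qp] <-].
  by have := qp (- x); have := sublinearN x sq; lra.
have infE x q : Q q -> inf (E x) <= q x.
  by move=> Qq; apply: ge_inf => //; exists q.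
have le_infE x c : (forall q, Q q -> c <= q x) -> c <= inf (E x).
  move=> cE; apply: lb_le_inf; first by exists (q0 x), q0.
  by move=> _ [q Qq <-]; exact: cE.
exists (fun x => inf (E x)); split=> [|x|q Qq x]; last exact: infE.
- split=> [x y|t x t0].
    rewrite -lerBlDr; apply: (le_infE) => q Qq; rewrite lerBlDr -lerBlDl.
    apply: (le_infE) => r Qr; rewrite lerBlDl.
    have [[qD _] _] := sQ _ Qq; have [[rD _] _] := sQ _ Qr.
    have := infE (x + y) _ Qq; have := infE (x + y) _ Qr.
    have := qD x y; have := rD x y.
    (* Whichever of q and r is the smaller controls the infimum at x + y. *)
    by case: (tQ _ _ Qq Qr) => [/(_ y)|/(_ x)]; lra.
  rewrite mulrC -ler_pdivrMr//; apply: (le_infE) => q Qq; rewrite ler_pdivrMr// mulrC.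
  by apply: le_trans (infE _ _ Qq) _; have [[_ ->]] := sQ _ Qq.
- by apply: le_trans (infE _ _ Qq0) _; have [_] := sQ _ Qq0.
Qed.

(** A minimal sublinear functional is linear, since [sublinear_inf] applied to
    the ray through [(y, q y)] gives [q (- y) <= - q y]. *)
Theorem hahn_banach p : sublinear p ->
  exists u : {linear V -> R^o}, forall x, u x <= p x.
Proof.
move=> sp; pose T := {q | sublinear q /\ forall x, q x <= p x}.
(* The order is reversed, so that a maximal element is a minimal functional. *)
pose rel (q r : T) := `[< forall x, sval r x <= sval q x >].
have [|||[q [sq qp]] minq] := @ZL_preorder T (exist _ p (conj sp (fun=> lexx _))) rel.
- by move=> q; apply/asboolP.
- move=> r q s /asboolP rq /asboolP qs; apply/asboolP => x.
  exact: le_trans (qs x) (rq x).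
- move=> Q tQ; have [[q0 Qq0]|Q0] := pselect (Q !=set0); last first.
    by exists (exist _ p (conj sp (fun=> lexx _))) => q Qq; case: Q0; exists q.
  have [|_ [r Qr <-]|_ _ [q Qq <-] [r Qr <-]|q' [sq' q'p q'Q]] :=
    @sublinear_chain p [set sval q | q in Q].
  + by exists (sval q0), q0.
  + exact: (svalP r).
  + by case: (tQ _ _ Qq Qr) => /asboolP; [right|left].
  + exists (exist _ q' (conj sq' q'p)) => q Qq; apply/asboolP => x.
    by apply: q'Q; exists q.
have qN y : q (- y) = - q y.
  apply/eqP; rewrite eq_le; apply/andP; split; last first.
    by have := sublinearN y sq; lra.
  have [||||q' [sq' q'q q'y]] := @sublinear_inf q
      [set k | exists2 t, 0 <= t & k = (t *: y, t * q y)] sq.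
  + by exists 0 => //; rewrite scale0r mul0r.
  + move=> _ _ [t t0 ->] [s s0 ->]; exists (t + s); first exact: addr_ge0.
    by rewrite scalerDl mulrDl.
  + move=> t _ _ t0 [s s0 [-> ->]]; exists (t * s); first by rewrite mulr_ge0// ltW.
    by rewrite scalerA mulrA.
  + move=> _ _ [t t0 [-> ->]]; have [->|tN0] := eqVneq t 0.
      by rewrite mul0r scale0r sublinear0.
    have {}t0 : 0 < t by rewrite lt_def tN0.
    have := sq.2 t^-1 (t *: y); rewrite invr_gt0 => /(_ t0).
    by rewrite scalerK// -ler_pdivlMl.
  apply: le_trans (q'y y (q y) _); last by exists 1; rewrite // scale1r mul1r.
  have := minq (exist _ q' (conj sq' (fun x => le_trans (q'q x) (qp x)))).
  have rq : rel (exist _ q (conj sq qp))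
      (exist _ q' (conj sq' (fun x => le_trans (q'q x) (qp x)))) by apply/asboolP.
  by move=> /(_ rq) /asboolP; exact.
have qD x y : q (x + y) = q x + q y.
  apply/eqP; rewrite eq_le sq.1 /=.
  by have := sq.1 (- x) (- y); rewrite -opprD !qN; lra.
have qZ t x : 0 < t -> q (t *: x) = t * q x.
  move=> t0; apply/eqP; rewrite eq_le sq.2//=.
  by have := sq.2 t (- x) t0; rewrite scalerN !qN; lra.
have ql : linear (q : V -> R^o).
  move=> t x y; rewrite qD; congr (_ + _).
  case: (ltgtP t 0) => [t0|t0|->]; [|exact: qZ|by rewrite !scale0r sublinear0].
  have := @qZ (- t) x; rewrite oppr_gt0 => /(_ t0).
  by rewrite scaleNr qN mulNr => /oppr_inj.
pose u : {linear V -> R^o} :=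
  HB.pack (q : V -> R^o) (GRing.isLinear.Build _ _ _ _ (q : V -> R^o) ql).
by exists u.
Qed.

End HahnBanach.

(** Restriction of scalars to the reals; the alias keeps the real module structure apart from the
    complex one. *)
Definition realification (R : rcfType) (V : lmodType R[i]) : Type := V.

Section Realification.
Context {R : rcfType} {V : lmodType R[i]}.
Local Notation W := (realification V).

HB.instance Definition _ := GRing.Zmodule.copy W V.

Let scaleR (t : R) (x : W) : W := t%:C *: (x : V).

Let scaleRA s t x : scaleR s (scaleR t x) = scaleR (s * t) x.
Proof. by rewrite /scaleR scalerA rmorphM. Qed.

Let scale1R : left_id 1 scaleR.
Proof. by move=> x; rewrite /scaleR scale1r. Qed.

Let scaleRDr : right_distributive scaleR +%R.
Proof. by move=> t x y; exact: scalerDr. Qed.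

Let scaleRDl x : {morph scaleR^~ x : s t / s + t}.
Proof. by move=> s t; rewrite /scaleR rmorphD; exact: scalerDl. Qed.

HB.instance Definition _ := GRing.Zmodule_isLmodule.Build R W
  scaleRA scale1R scaleRDr scaleRDl.

Lemma realificationZ t (x : V) : t *: (x : W) = t%:C *: x. Proof. by []. Qed.

End Realification.

(** * Separating a point from a closed complex subspace *)

Section Separation.
Context {R : realType} {V : normedModType R[i]}.
Implicit Types (x y : V) (t : R).

(** Norms over [R[i]] have values in [R[i]]; their real part serves as the real sublinear
    functional. *)
Lemma Re_norm x : (complex.Re `|x|)%:C = `|x|.
Proof. by have := ger0_Im (normr_ge0 x); case: `|x| => a b /= ->. Qed.

Lemma Re_normD x y :
  complex.Re `|x + y| <= complex.Re `|x| + complex.Re `|y|.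
Proof. by rewrite -lecR rmorphD /= !Re_norm ler_normD. Qed.

Lemma Re_normZ t x : 0 < t ->
  complex.Re `|t%:C *: x| = t * complex.Re `|x|.
Proof.
move=> t0; apply: complexI; rewrite rmorphM /= !Re_norm normrZ gtr0_norm//.
by rewrite (ltcR 0).
Qed.

Lemma separation (C : set V) x0 : closed C -> submod_closed (mem C) -> ~ C x0 ->
  exists J : set V, [/\ closed J, submod_closed (mem J), C `<=` J,
    ~ J x0 & finite_codim setT J].
Proof.
move=> cC sC nCx0.
have [d d0 dC] : exists2 d : R, 0 < d &
    forall c, C c -> d <= complex.Re `|x0 - c|.
  have : nbhs x0 (~` C) by apply: open_nbhs_nbhs; split=> //; exact: closed_openC.
  move=> /nbhs_ballP[e /= e0 eC]; exists (complex.Re e).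
    by move: e0; rewrite ltcE => /andP[_].
  move=> c Cc; rewrite leNgt; apply/negP => lte; apply: (eC c) => //.
  rewrite -ball_normE /=  -Re_norm.
  have -> : e = (complex.Re e)%:C by have := ger0_Im (ltW e0); case: (e) => a b /= ->.
  by rewrite ltcR.
(* Lowering the norm along this cone forces u (t x0 - c) >= t d. The norm allows it: for t > 0, t x0
   - c is t times x0 - c / t, of norm at least d. *)
pose N := [set k : realification V * R |
  exists2 t, 0 <= t & exists2 c, C c & k = (t%:C *: x0 - c, t * d)].
have sub_norm : sublinear (fun x : realification V => complex.Re `|x : V|).
  by split=> [x y|t x t0]; [exact: Re_normD|rewrite realificationZ Re_normZ].
have [||||q' [sq' q'q q'N]] := sublinear_inf sub_norm (K := N).
- exists 0 => //; exists 0; first by have /submod_closedP[] := sC.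
  by rewrite subr0 rmorph0 scale0r mul0r.
- move=> _ _ [t t0 [c Cc ->]] [s s0 [b Cb ->]]; exists (t + s); first exact: addr_ge0.
  exists (c + b); first exact: subspaceD.
  by rewrite rmorphD scalerDl mulrDl opprD addrACA.
- move=> s _ _ s0 [t t0 [c Cc [-> ->]]]; exists (s * t).
    by rewrite mulr_ge0// ltW.
  exists (s%:C *: c); first exact: subspaceZ.
  by rewrite realificationZ scalerBr scalerA rmorphM mulrA.
- move=> _ _ [t t0 [c Cc [-> ->]]]; have [->|tN0] := eqVneq t 0.
    by rewrite mul0r -lecR Re_norm; exact: normr_ge0.
  have {}t0 : 0 < t by rewrite lt_def tN0.
  have -> : t%:C *: x0 - c = t%:C *: (x0 - (t%:C)^-1 *: c).
    by rewrite scalerBr scalerA divff ?scale1r// gt_eqF// (ltcR 0).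
  by rewrite Re_normZ// ler_pM2l//; apply: dC; exact: subspaceZ.
have [u uq'] := hahn_banach sq'.
have uN t c : 0 <= t -> C c -> u (- (t%:C *: x0 - c)) <= - (t * d).
  by move=> t0 Cc; apply: le_trans (uq' _) (q'N _ _ _); exists t => //; exists c.
have u_le x : u x <= complex.Re `|x|.
  by apply: le_trans (uq' x) _; exact: q'q.
have uNx x : u (- x) = - u x by exact: linearN.
have uD x y : u (x + y) = u x + u y by exact: linearD.
have uZ t x : u (t%:C *: x) = t * u x by exact: (linearZZ u).
have u_norm x : `|u x| <= complex.Re `|x|.
  by rewrite ler_norml u_le andbT lerNl -uNx -(normrN x) u_le.
have C0 : C 0 by have /submod_closedP[] := sC.
have ux0 : 0 < u x0.
  have := uN 1 0 ler01 C0; rewrite subr0 rmorph1 scale1r uNx; lra.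
(* The constraint with t = 0 bounds u by zero at both c and -c. *)
have uC c : C c -> u c = 0.
  move=> Cc; have CNc : C (- c) by rewrite -scaleN1r; exact: subspaceZ.
  have := uN 0 _ (lexx 0) Cc; have := uN 0 _ (lexx 0) CNc.
  by rewrite rmorph0 scale0r !sub0r !opprK uNx; lra.
have uc k x : u (k *: x) = complex.Re k * u x + complex.Im k * u ('i *: x).
  by rewrite {1}[k]complexE scalerDl uD uZ ['i * _]mulrC -scalerA uZ.
have ui x : u ('i *: ('i *: x)) = - u x.
  by rewrite scalerA -expr2 sqr_i scaleN1r uNx.
(* This is the kernel of the complex linear functional f x = u x - i u (i x). *)
exists [set x | u x = 0 /\ u ('i *: x) = 0]; split.
- move=> x xcl.
  have le_eps e : 0 < e -> `|u x| <= e /\ `|u ('i *: x)| <= e.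
    move=> e0; have [|z [[uz uiz] xz]] := xcl (ball x e%:C).
      by apply: nbhsx_ballx; rewrite (ltcR 0).
    have {}xz : complex.Re `|x - z| < e.
      by move: xz; rewrite -ball_normE /= -Re_norm ltcR.
    have -> : u x = u (x - z) by rewrite uD uNx uz subr0.
    have -> : u ('i *: x) = u ('i *: (x - z)).
      by rewrite scalerBr uD uNx uiz subr0.
    split; apply: le_trans (u_norm _) _; first exact: ltW.
    by rewrite normrZ normc_def /= expr0n expr1n add0r sqrtr1 mul1r ltW.
  by split; apply/eqP; rewrite -normr_le0; apply/ler_addgt0Pr => e /le_eps[];
    rewrite add0r.
- apply/submod_closedP; split=> /= [|k x y [ux uix] [uy uiy]].
    by rewrite scaler0; split; exact: linear0.
  rewrite scalerDr !uD uy uiy scalerA ['i * k]mulrC -scalerA.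
  rewrite (uc k x) (uc k ('i *: x)) ui ux uix.
  by rewrite !(mulr0, oppr0, addr0).
- by move=> c Cc /=; rewrite !uC//; exact: subspaceZ.
- by move=> /= [ux _]; rewrite ux ltxx in ux0.
- exists 1%N, (fun=> x0); split=> // y _.
  pose a := u x0; pose b := u ('i *: x0); pose n := a ^+ 2 + b ^+ 2.
  have n0 : n != 0 by rewrite gt_eqF// ltr_wpDr ?sqr_ge0// exprn_gt0.
  (* This is f y / f x0 in real and imaginary parts; n is the squared modulus of f x0, nonzero since
     u x0 > 0. *)
  pose k : R[i] :=
    ((a * u y + b * u ('i *: y)) / n) +i* ((b * u y - a * u ('i *: y)) / n).
  exists (y - k *: x0); last first.
    by rewrite subKr; exists 1%N, (fun=> k), (fun=> x0); split=> [i|];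
      [exists ord0|rewrite big_ord1].
  have uik : u ('i *: (k *: x0)) = complex.Re k * b - complex.Im k * a.
    by rewrite scalerA ['i * k]mulrC -scalerA uc ui mulrN.
  split; first by rewrite /= uD uNx (uc k x0) /= -/a -/b /n; field.
  by rewrite /= scalerBr uD uNx uik /= -/a -/b /n; field.
Qed.
End Separation.

(** * A criterion for finite dimension *)

Section FiniteDimension.
Context {K : numFieldType} {V : normedModType K}.

Lemma lspan_rangeP n (v : 'I_n -> V) x : lspan (range v) x ->
  exists c : 'I_n -> K, x = \sum_i c i *: v i.
Proof.
have h : submod_closed (mem [set x | exists c : 'I_n -> K, x = \sum_i c i *: v i]).
  apply/submod_closedP; split=> [|k _ _ [c ->] [d ->]].
    by exists (fun=> 0); rewrite big1// => i _; rewrite scale0r.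
  exists (fun i => k * c i + d i); rewrite scaler_sumr -big_split /=.
  by apply: eq_bigr => i _; rewrite scalerDl scalerA.
apply: lspan_sub h _ _ => _ [i _ <-]; exists (fun j => (j == i)%:R).
rewrite (bigD1 i)//= eqxx scale1r big1 ?addr0// => j /negPf ->.
by rewrite scale0r.
Qed.

(** Lifting of relations replaces linearity and injectivity of [r], which may come from a choice of
    coordinates. A family of maximal size with independent images spans: adding x to it creates a
    relation, which lifts to [V]. *)
Lemma finite_dimensional_relations m (r : V -> 'rV[K]_m) :
  (forall n (c : 'I_n -> K) (v : 'I_n -> V),
    \sum_i c i *: r (v i) = 0 -> \sum_i c i *: v i = 0) ->
  finite_dimensional V.
Proof.
move=> rel; pose P k := `[< exists a : 'I_k -> V, row_free (\matrix_i r (a i)) >].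
have P0 : exists k, P k.
  by exists 0%N; apply/asboolP; exists (fun=> 0); rewrite -row_leq_rank.
have Pm k : P k -> (k <= m)%N.
  by move=> /asboolP[a /eqP <-]; exact: rank_leq_col.
have [k /asboolP[a a_free] maxk] := ex_maxnP P0 Pm.
exists k, a; apply/seteqP; split=> // x _.
pose b (i : 'I_(k + 1)) := match fintype.split i with inl j => a j | inr _ => x end.
have bl i : b (lshift 1 i) = a i by rewrite /b (unsplitK (inl i)).
have br i : b (rshift k i) = x by rewrite /b (unsplitK (inr i)).
have : ~~ row_free (\matrix_i r (b i)).
  apply/negP => b_free; suff /maxk : P (k + 1)%N by rewrite addn1 ltnn.
  by apply/asboolP; exists b.
rewrite -kermx_eq0 => /rowV0Pn[w /sub_kermxP wb wN0].
have wr : \sum_i w 0 i *: r (b i) = 0.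
  by rewrite -[RHS]wb mulmx_sum_row; apply: eq_bigr => i _; rewrite rowK.
(* Without x, the relation would be one between independent rows. *)
have wN : w 0 (rshift k ord0) != 0.
  apply: contra_neq wN0 => w0.
  move: wr; rewrite big_split_ord big_ord1 /= w0 scale0r addr0 => wl0.
  have : lsubmx w *m (\matrix_i r (a i)) = 0.
    rewrite mulmx_sum_row -[RHS]wl0; apply: eq_bigr => i _.
    by rewrite rowK bl mxE.
  move/eqP; rewrite mulmx_free_eq0// => /eqP wl.
  rewrite -[w]hsubmxK wl; apply/rowP => i; rewrite mxE.
  by case: splitP => j _; rewrite !mxE// ord1 w0.
have := rel _ _ _ wr; rewrite big_split_ord big_ord1 /= br => /eqP.
rewrite addrC addr_eq0 => /eqP wx.
rewrite -[x](scalerK wN) wx.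
apply: subspaceZ (subspace_lspan _) _ _ _.
rewrite -scaleN1r; apply: subspaceZ (subspace_lspan _) _ _ _.
apply: subspace_sum (subspace_lspan _) _ _ _ _ => i; rewrite bl.
by apply: sub_lspan; exists i.
Qed.

End FiniteDimension.

(** * Algebras whose commutators span a finite-dimensional space *)

Section CommutatorSpan.
Context {K : numFieldType} {A : banachAlgType K}.
Hypothesis simpleA : topologically_simple A.
Hypothesis centerA : alg_center A = [set 0].

(** The dichotomy is applied to the centralizer [J] of the v i. If [J] contains all commutators,
    they vanish and [A] is zero; if [J] is zero, a is determined by the matrix of its derivation on
    the v i. *)
Lemma finite_dimensional_com n (v : 'I_n -> A) :
  (forall x y, lspan (range v) [com x, y]) -> finite_dimensional A.
Proof.
move=> spanv.
pose J : set A := [set a | forall i, [com a, v i] = 0].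
have sJ : submod_closed (mem J).
  apply/submod_closedP; split=> [i|k x y Jx Jy i]; first by rewrite com0l.
  by rewrite comDl comZl Jx Jy scaler0 addr0.
have cJ : closed J.
  by apply: closed_forall => i; apply: closed_eq0; exact: com_continuous.
have com_span j x : J j -> lspan (range v) x -> [com j, x] = 0.
  move=> Jj; apply: (@lspan_sub _ _ _ [set x | [com j, x] = 0]).
    apply/submod_closedP; split=> [|k y z /= jy jz]; first exact: com0r.
    by rewrite comDr comZr jy jz scaler0 addr0.
  by move=> _ [i _ <-]; exact: Jj.
have [j x y Jj i|Jcom|J0] := lie_ideal_dichotomy simpleA centerA cJ sJ.
- by rewrite (com_span j)// com0l.
- have com0 (x y : A) : [com x, y] = 0.
    apply: (ad_sq_com_eq0 (simple_prime simpleA centerA) (com_center centerA)).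
    by move=> p q; rewrite (com_span _ _ (Jcom x y))// com0r.
  exists 0%N, (fun=> 0); apply/seteqP; split=> // x _.
  rewrite (com_center centerA (com0 x)).
  by have /submod_closedP[] := subspace_lspan (range (fun _ : 'I_0 => 0 : A)).
(* The v i may be dependent, so coordinates are chosen. A relation between the matrices still puts
   the same combination of elements in [J]. *)
have [M MP] : exists M : A -> 'M[K]_n,
    forall a i, [com a, v i] = \sum_j M a i j *: v j.
  have h a i : exists c : 'I_n -> K, [com a, v i] = \sum_j c j *: v j.
    exact: lspan_rangeP.
  exists (fun a => \matrix_(i, j) sval (cid (h a i)) j) => a i.
  by rewrite {1}(svalP (cid (h a i))); apply: eq_bigr => j _; rewrite mxE.
apply: (@finite_dimensional_relations _ _ _ (fun a => mxvec (M a))) => m c a ca0.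
apply: J0 => i.
have com_sum : [com \sum_k c k *: a k, v i] = \sum_k c k *: [com a k, v i].
  elim/big_ind2 : _ => [|x x' y y' <- <-|k _]; first exact: com0l.
    by rewrite comDl.
  by rewrite comZl.
rewrite com_sum.
under eq_bigr => k _ do rewrite MP scaler_sumr.
rewrite exchange_big big1//= => j _.
under eq_bigr => k _ do rewrite scalerA.
rewrite -scaler_suml (_ : \sum_k _ = 0) ?scale0r//.
have := congr1 (fun w : 'rV[K]_(n * n) => w 0 (mxvec_index i j)) ca0.
rewrite summxE mxE => e; rewrite -[RHS]e; apply: eq_bigr => k _.
by rewrite mxE mxvecE.
Qed.

End CommutatorSpan.

(** * The transfinite sequence and its stable value *)

Section Frattini.
Context {R : realType} {A : banachAlgType R[i]}.
Hypothesis simpleA : topologically_simple A.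
Hypothesis infA : ~ finite_dimensional A.
Hypothesis centerA : alg_center A = [set 0].
Local Notation L := (commutator_lie A).
Local Notation C :=
  (closure (lspan [set commutator x y | x in [set: A] & y in [set: A]])).

Lemma closure_lspan_com (x y : A) : C [com x, y].
Proof. by apply: subset_closure; apply: sub_lspan; exists x => //; exists y. Qed.

Lemma closure_lspan_com_sub (J : set A) : closed J -> submod_closed (mem J) ->
  (forall x y : A, J [com x, y]) -> C `<=` J.
Proof.
move=> cJ sJ Jcom; apply: closure_min => //; apply: lspan_sub => //.
by move=> _ [x _ [y _ <-]]; exact: Jcom.
Qed.

(** This serves for [M] equal to [A] and to [C]. If [J] were zero, finite codimension would put all
    commutators in a finite span, against [finite_dimensional_com]. *)
Lemma closed_lie_ideal_finite_codim (M J : set A) :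
  closed J -> submod_closed (mem J) ->
  (forall j x y : A, J j -> J [com j, [com x, y]]) ->
  (forall x y : A, M [com x, y]) -> finite_codim M J -> C `<=` J.
Proof.
move=> cJ sJ JC Mcom [n [v [_ vM]]].
have [//|Jcom|J0] := lie_ideal_dichotomy simpleA centerA cJ sJ.
  exact: closure_lspan_com_sub.
case: infA; apply: (finite_dimensional_com simpleA centerA (v := v)) => x y.
by have [z /J0 ->] := vM _ (Mcom x y); rewrite subr0.
Qed.

(** A point outside [C] is missed by some [J] from [separation], which is a Lie ideal because it
    contains all commutators. *)
Lemma PJ_setT : PJ [set: L] = C.
Proof.
apply/seteqP; split=> [x [_ PJx]|x Cx].
  apply: contrapT => nCx.
  have [|J [cJ sJ CJ nJx fJ]] := separation (@closed_closure _ _) _ nCx.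
    by apply: subspace_closure; exact: subspace_lspan.
  apply: (nJx); apply: PJx => // [|JT].
    split=> // a y _ _; apply: CJ; exact: (@closure_lspan_com a y).
  by apply: nJx; rewrite JT.
split=> // J cJ [sJ _ JL] fJ _.
apply: (@closed_lie_ideal_finite_codim [set: A] J) Cx => // j y z Jj.
rewrite comC -scaleN1r; apply: (subspaceZ sJ).
exact: (JL ([com y, z] : L)).
Qed.

(** Commutators of [A] lie in [C], so an ideal of [C] is stable under them; with finite codimension
    it contains [C] and is not proper. *)
Lemma PJ_closure_lspan_com : PJ (C : set L) = C.
Proof.
apply/seteqP; split=> [x []//|x Cx].
split=> // J cJ [sJ JC JL] fJ nJ.
have CJ : C `<=` J.
  apply: (@closed_lie_ideal_finite_codim C J) => // [j y z Jj|y z].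
    rewrite comC -scaleN1r; apply: (subspaceZ sJ).
    by apply: (JL ([com y, z] : L)) => //; exact: closure_lspan_com.
  exact: closure_lspan_com.
by case: nJ; apply/seteqP; split.
Qed.

End Frattini.

Theorem proposition7p17 (R : realType) (A : banachAlgType R[i])
    (simpleA : topologically_simple A)
    (infA : ~ finite_dimensional A)
    (centerA : alg_center A = [set 0]) :
  frattini_radical (commutator_lie A) =
  closure (lspan [set commutator x y | x in [set: A] & y in [set: A]]).
Proof.
(* Two indices suffice, [false] below [true]: the sequence is stationary from its first step on. *)
apply: frattini_radical_eq; exists bool, implb; split.
  apply: wochoice.antisymmetric_well_order => [[] []//|D [b Db]].
  have [D0|nD0] := boolP (false \in D); first by exists false; split.
  have D1 : true \in D by case: b Db => // D0; case/negP: nD0.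
  by exists true; split=> // -[] // D0; case/negP: nD0.
have ltE i j : strictly_below implb i j -> i = false /\ j = true.
  by case: i j => [] [] // [].
have lt01 : strictly_below implb false true by [].
exists (fun i : bool => if i then
    closure (lspan [set commutator x y | x in [set: A] & y in [set: A]])
  else setT).
  (* No index is a limit: [false] is the zero and [true] its successor. *)
  split=> [[] //= i0|i j [/ltE[-> ->] _]|[] [nz ns]].
  - by case: (i0 _ lt01).
  - by rewrite PJ_setT.
  - by case: (ns false); split=> // k [/ltE[_ ->] /ltE[]].
  - by case: nz => k /ltE[].
by exists true => //; exact: PJ_closure_lspan_com.
Qed.
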